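(* Let $\mu>0$ and let $\eta:\mathbb{R}^m\to\mathbb{R}^m$ be the element-wise symmetric clipping operator, $\eta(\boldsymbol{u})_j=-\mu$ if $u_j\le-\mu$, $\eta(\boldsymbol{u})_j=u_j$ if $|u_j|<\mu$, $\eta(\boldsymbol{u})_j=\mu$ if $u_j\ge\mu$. Let $\mathcal{X}\subseteq\mathbb{R}^n$ be a cone and let $S_\mathcal{X}=\{\boldsymbol{x}/\|\boldsymbol{x}\|_2:\boldsymbol{x}\in\mathcal{X}\setminus\{0\}\}$. Assume $S_\mathcal{X}$ has finite upper box-counting dimension $\dim(S_\mathcal{X})<k$ and that there is $\epsilon^*\in(0,1/2)$ with $N_{S_\mathcal{X}}(\epsilon)\le\epsilon^{-k}$ for all $\epsilon<\epsilon^*$. Let $\boldsymbol{A}\in\mathbb{R}^{m\times n}$ have i.i.d. entries $A_{ij}\sim\mathcal{N}(0,1)$, and for $R>0$ let $\mathcal{X}_R=\{\boldsymbol{x}\in\mathcal{X}:\|\boldsymbol{x}\|_2<R\}$. There exists an absolute constant $C>0$ such that, if $m\ge k\log(1/\epsilon^* )$ and $R<\mu\left(\tfrac12-\tfrac{k+1}{m}\right)$, then $$\mathbb{P}\big(\eta(\boldsymbol{A}\boldsymbol{x})=\eta(\boldsymbol{A}\boldsymbol{u})\text{ for some }\boldsymbol{x}\neq\boldsymbol{u}\in\mathcal{X}_R\big)\le 12e^{-Cm}.$$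
   Context: A set $\mathcal{X}$ is a cone if $g\mathcal{X}=\mathcal{X}$ for all $g>0$. For a compact set $\mathcal{S}$, the covering number $N_\mathcal{S}(\epsilon)$ is the minimum number of closed Euclidean balls of radius $\epsilon$ with centres in $\mathcal{S}$ needed to cover $\mathcal{S}$, and the upper box-counting dimension is $\dim(\mathcal{S})=\limsup_{\epsilon\to0}\log N_\mathcal{S}(\epsilon)/(-\log\epsilon)$. *)

(* Defs.v *)
From HB Require Import structures.
From mathcomp Require Import all_boot all_order all_algebra.
From mathcomp Require Import all_classical all_reals all_analysis.
From mathcomp Require Import Rstruct Rstruct_topology.
From Stdlib Require Import Rdefinitions.
Set Implicit Arguments. Unset Strict Implicit. Unset Printing Implicit Defensive.
Import Order.TTheory GRing.Theory Num.Theory.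
Local Open Scope classical_set_scope.
Local Open Scope ring_scope.

Notation RR := Rdefinitions.R.

Definition norm2 {n : nat} (x : 'cV[RR]_n) : RR := Num.sqrt (\sum_i (x i 0) ^+ 2).

Definition clip (mu : RR) {m : nat} (v : 'cV[RR]_m) : 'cV[RR]_m :=
  \col_i (if v i 0 <= - mu then - mu else if mu <= v i 0 then mu else v i 0).

Definition is_cone {n : nat} (X : set 'cV[RR]_n) : Prop :=
  forall g : RR, 0 < g -> [set g *: x | x in X] = X.

Definition sphere_proj {n : nat} (X : set 'cV[RR]_n) : set 'cV[RR]_n :=
  [set (norm2 x)^-1 *: x | x in X `\ 0].

Definition ball_part {n : nat} (X : set 'cV[RR]_n) (r : RR) : set 'cV[RR]_n :=
  [set x | X x /\ norm2 x < r].

Definition is_cover {n : nat} (S : set 'cV[RR]_n) (eps : RR) (c : seq 'cV[RR]_n) : Prop :=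
  (forall y, y \in c -> S y) /\
  (forall x, S x -> exists2 y, y \in c & norm2 (x - y) <= eps).

(* covering number N_S(eps) (+oo if no finite cover exists) *)
Definition covering_number {n : nat} (S : set 'cV[RR]_n) (eps : RR) : \bar RR :=
  ereal_inf [set ((size c)%:R)%:E | c in [set c | is_cover S eps c]].

Definition box_ratio {n : nat} (S : set 'cV[RR]_n) (eps : RR) : \bar RR :=
  match covering_number S eps with
  | EFin r => (ln r / (- ln eps))%:E
  | +oo%E => +oo%E
  | -oo%E => -oo%E
  end.

(* upper box-counting dimension: limsup_{eps -> 0+} log N_S(eps) / (- log eps) *)
Definition upper_box_dim {n : nat} (S : set 'cV[RR]_n) : \bar RR :=
  ereal_inf [set ereal_sup [set box_ratio S e | e in `]0, d[%classic]
            | d in `]0, 1[%classic].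

Definition mutually_independent {d : measure_display} {T : measurableType d}
  (P : probability T RR) (I : finType) (X : I -> T -> RR) : Prop :=
  forall B : I -> set RR, (forall i, measurable (B i : set (RR : realType))) ->
    P (\bigcap_i (X i @^-1` B i)) = (\prod_(i : I) P (X i @^-1` B i))%E.

Definition rmatrix {d : measure_display} {T : measurableType d} {m n : nat}
  (A : 'I_m -> 'I_n -> T -> RR) (w : T) : 'M[RR]_(m, n) :=
  \matrix_(i, j) A i j w.

(* P(E) <= b, for a possibly non-measurable event E, read as an outer probability bound *)
Definition prob_le {d : measure_display} {T : measurableType d}
  (P : probability T RR) (E : set T) (b : RR) : Prop :=
  exists2 F : set T, measurable F /\ E `<=` F & (P F <= b%:E)%E.

(* Main.v *)
Require Import Defs.
From HB Require Import structures.
From mathcomp Require Import all_boot all_order all_algebra.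
From mathcomp Require Import all_classical all_reals all_analysis.
From mathcomp Require Import Rstruct Rstruct_topology.
From mathcomp Require Import measurable_realfun exp ring lra.
Import Order.TTheory GRing.Theory Num.Theory.
Local Open Scope classical_set_scope.
Local Open Scope ring_scope.

(** Put tau = 1/2 - (k + 1)/m, so that 2 tau m = m - 2 (k + 1) and r < mu tau.
    If clip (A x) = clip (A u), then x and u have the same set J of unclipped
    coordinates, and A x = A u on J.  Hence one of two events occurs.

    Collision: #|J| > 2 (k + 1).  The bounded part of X has covering numbers
    O(eps^-(k+1)), so there are O(eps^-(2k+2)) pairs of centres, and a pair at
    distance at least delta is mapped O(eps)-close on J with probability
    O(eps^#|J|); letting eps tend to 0, this event is null.

    Saturation: at least 2 tau m coordinates of A x are clipped.  With
    s = x / |x| and a suitable sign vector f this gives <f, A s> > theta for a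
    threshold theta, and the process s |-> <f, A s> is Gaussian with variance
    |f|^2 |s - s'|^2.  Since k ln (1/epsS) <= m, one can chain along the scales
    q^i, where q < epsS and q^-k <= e^(m+1), with at most 2 e^(i (m+1)) points
    at scale q^i.  Absolute constants only work out after a case distinction: for
    tau > 2/9 take all f in {-1,1}^m with theta = 2 m and use q <= e^(-18/5);
    for tau <= 2/9 take f in {-1,0,1}^m supported on the clipped coordinates
    with theta = |f|^2 / tau and use q <= e^(-2). *)

Set Implicit Arguments. Unset Strict Implicit. Unset Printing Implicit Defensive.

(** * Splitting one variable off an independent family *)

(** A pi-system generating the sigma-algebra of all variables other than [X e]. Keeping an index
    [e], with [setT] there, lets the product formula of [indep] apply to its members directly. *)
Definition cylinders {d d' : measure_display} {T : measurableType d} {U : measurableType d'}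
    {E : finType} (X : E -> T -> U) (e : E) : set (set T) :=
  [set \bigcap_i (X i @^-1` B i) | B in
    [set B : E -> set U | (forall i, measurable (B i)) /\ B e = setT]].

Definition indep {d d' : measure_display} {T : measurableType d}
    {U : measurableType d'} {R : realType} (P : probability T R)
    {E : finType} (X : E -> T -> U) : Prop :=
  forall B : E -> set U, (forall i, measurable (B i)) ->
    P (\bigcap_i (X i @^-1` B i)) = (\prod_(i : E) P (X i @^-1` B i))%E.

Lemma cylinders_setI_closed (d d' : measure_display) (T : measurableType d) (U : measurableType d')
    (E : finType) (X : E -> T -> U) (e : E) :
  setI_closed (cylinders X e).
Proof.
move=> _ _ [B [mB Be] <-] [C [mC Ce] <-].
exists (fun i => B i `&` C i).
  by split=> [i|]; [exact: measurableI | rewrite Be Ce setIT].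
apply/seteqP; split=> [w h|w [h1 h2] i _].
  by split=> i _; have [] := h i I.
by split; [exact: h1|exact: h2].
Qed.

Lemma cylinders_measurable (d d' : measure_display) (T : measurableType d) (U : measurableType d')
    (E : finType) (X : E -> T -> U) (e : E) :
  (forall i, measurable_fun setT (X i)) ->
  <<s cylinders X e >> `<=` measurable.
Proof.
move=> mX; apply: smallest_sub; first exact: sigma_algebra_measurable.
move=> _ [B [mB _] <-].
by apply: fin_bigcap_measurable => // i _; rewrite -[_ @^-1` _]setTI; exact: mX.
Qed.

Lemma cylinders_measurable_fun (d d' : measure_display) (T : measurableType d)
    (U : measurableType d')
    (E : finType) (X : E -> T -> U) (e i : E) :
  (forall i, measurable_fun setT (X i)) -> i != e ->
  measurable_fun setT (X i : g_sigma_algebraType (cylinders X e) -> U).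
Proof.
move=> mX ie _ B mB; rewrite setTI; apply: sub_sigma_algebra.
exists (fun j => if j == i then B else setT).
  split=> [j|]; first by case: ifP.
  by rewrite eq_sym (negbTE ie).
apply/seteqP; split=> [w /(_ i I)|w h j _] /=; first by rewrite eqxx.
by case: ifP => // /eqP ->.
Qed.

(** Both sides are finite measures in [H], so it suffices to compare them on the pi-system
    [cylinders X e]. There independence is applied twice: with [B] at index [e] and with [setT] at
    index [e]. *)
Lemma indep_cylinders (d d' : measure_display) (T : measurableType d) (U : measurableType d')
    (R : realType) (P : probability T R) (E : finType) (X : E -> T -> U) (e : E)
    (B : set U) (H : set T) :
  (forall i, measurable_fun setT (X i)) -> indep P X ->
  measurable B -> <<s cylinders X e >> H ->
  P (X e @^-1` B `&` H) = (P (X e @^-1` B) * P H)%E.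
Proof.
move=> mX iX mB.
have mXB : measurable (X e @^-1` B) by rewrite -[_ @^-1` _]setTI; exact: mX.
have mcyl := @cylinders_measurable _ _ _ _ _ X e mX.
pose m1 := mrestr P mXB.
pose c := NngNum (fine_ge0 (measure_ge0 P (X e @^-1` B))).
have cE : (c%:num%:E = P (X e @^-1` B))%E by rewrite /c/= fineK// fin_num_measure.
pose m2 := mscale c P.
have -> : (P (X e @^-1` B) * P H)%E = m2 H.
  by rewrite /m2 /mscale cE.
rewrite setIC => sH.
apply: (@g_sigma_algebra_measure_unique _ _ _ (cylinders X e) _ (fun=> setT) _ _
  m1 m2 _ _ _ H sH) => //.
- by apply: subset_trans mcyl; exact: sub_sigma_algebra.
- by move=> _; exists (fun=> setT) => //; rewrite bigcapT.
- by apply/seteqP; split => // w _; exists 0%N.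
- exact: cylinders_setI_closed.
- move=> _ [C [mC Ce] <-]; rewrite /m2/= /mscale cE /m1/= /mrestr setIC.
  pose D i := if i == e then B else C i.
  have -> : X e @^-1` B `&` \bigcap_i (X i @^-1` C i) = \bigcap_i (X i @^-1` D i).
    apply/seteqP; split=> [w [h1 h2] i _|w h].
      by rewrite /D; case: ifP => [/eqP ->//|_]; exact: h2.
    split; first by have := h e I; rewrite /D eqxx.
    move=> i _; have := h i I; rewrite /D; case: ifP => // /eqP -> _.
    by rewrite Ce.
  rewrite iX; last by move=> i; rewrite /D; case: ifP.
  rewrite iX// (bigD1 e)//= [in RHS](bigD1 e)//= /D eqxx Ce preimage_setT.
  rewrite probability_setT mul1e; congr (_ * _)%E.
  by apply: eq_bigr => i /negbTE ->.
- by move=> _; rewrite /m1/= /mrestr setTI ltey_eq fin_num_measure.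
Qed.

(** The law of [(X e, w)], with [w] carrying the sigma-algebra of the other
    variables, is a product measure. *)
Lemma indep_integral (d d' : measure_display) (T : measurableType d) (U : measurableType d')
    (R : realType) (P : probability T R) (E : finType) (X : E -> T -> U) (e : E)
    (g : probability U R)
    (F : U * g_sigma_algebraType (cylinders X e) -> \bar R) :
  (forall i, measurable_fun setT (X i)) -> indep P X ->
  (forall B, measurable B -> P (X e @^-1` B) = g B) ->
  measurable_fun setT F -> (forall z, (0 <= F z)%E) ->
  (\int[P]_w F (X e w, w) = \int[P]_w \int[g]_x F (x, w))%E.
Proof.
move=> mX iX gX mF F0.
pose T' := g_sigma_algebraType (cylinders X e).
have mid : measurable_fun setT (id : T -> T').
  by move=> _ B mB; rewrite setTI preimage_id; exact: cylinders_measurable mB.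
have mpair : measurable_fun setT (fun w => (X e w, w) : (U * T')%type).
  by apply/measurable_fun_pairP; split; [exact: mX|exact: mid].
pose Id : {mfun T >-> T'} := HB.pack (id : T -> T')
  (isMeasurableFun.Build _ _ _ _ (id : T -> T') mid).
pose XId : {mfun T >-> (U * T')%type} := HB.pack
  (fun w => (X e w, w) : (U * T')%type)
  (isMeasurableFun.Build _ _ _ _ (fun w => (X e w, w) : (U * T')%type) mpair).
transitivity (\int[distribution P XId]_z F z)%E.
  by rewrite ge0_integral_distribution.
transitivity (\int[(g \x distribution P Id)%E]_z F z)%E.
  apply: eq_measure_integral => A mA _; apply/esym.
  apply: product_measure_unique => // B C mB mC.
  rewrite /distribution /pushforward/=.
  by have := indep_cylinders mX iX mB (mC : <<s cylinders X e >> C); rewrite gX.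
rewrite fubini_tonelli2//.
rewrite ge0_integral_distribution//.
  exact: measurable_fun_fubini_tonelli_G.
by move=> w; exact: integral_ge0.
Qed.

(** * Gaussian integrals, tails and small balls *)

(** The density is at most 1/sqrt(2 pi) <= 1/2, as pi >= 2. With this constant an interval of radius
    r has mass at most r. *)
Lemma normal_prob_itv_le (R : realType) (a b : R) : a <= b ->
  (normal_prob 0 1 `[a, b]%classic <= ((b - a) / 2)%:E)%E.
Proof.
move=> ab.
have peak : normal_peak 1 <= 2^-1 :> R.
  rewrite /normal_peak lef_pV2 ?posrE// ?sqrtr_gt0; last first.
    by rewrite expr1n mul1r mulrn_wgt0// pi_gt0.
  have -> : 2 = Num.sqrt (2 ^+ 2) :> R by rewrite sqrtr_sqr ger0_norm.
  rewrite ler_sqrt ?mulrn_wge0//; last by rewrite expr1n mul1r pi_ge0.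
  by rewrite expr1n mul1r -mulr_natr; have := pi_ge2 R; lra.
rewrite /normal_prob.
apply: (@le_trans _ _ (\int[lebesgue_measure]_(x in `[a, b]) (2^-1)%:E)%E).
  apply: ge0_le_integral => //=.
  - by move=> x _; rewrite lee_fin normal_pdf_ge0.
  - by apply/measurable_EFinP; apply: measurable_funTS; exact: measurable_normal_pdf.
  - by move=> x _; rewrite lee_fin (le_trans _ peak)// normal_pdf_ub.
rewrite integral_cst//= lebesgue_measure_itv/= lte_fin.
by case: ltP => // ?; rewrite ?mule0 ?lee_fin -?EFinM ?lee_fin ?EFinN; lra.
Qed.

(** The Radon-Nikodym derivative and [normal_pdf] have the same integral over every measurable set,
    hence agree almost everywhere. *)
Lemma normal_prob_integral (R : realType) (f : R -> \bar R) :
  measurable_fun setT f -> (forall x, (0 <= f x)%E) ->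
  (\int[normal_prob 0 1]_x f x =
   \int[lebesgue_measure]_x (f x * (normal_pdf 0 1 x)%:E))%E.
Proof.
move=> mf f0.
pose nu : probability (measurableTypeR R) R := normal_prob 0 1.
have nudom : nu `<< (@lebesgue_measure R) by exact: normal_prob_dominates.
have mpdf : measurable_fun setT (fun x : R => (normal_pdf 0 1 x)%:E).
  by apply/measurable_EFinP; exact: measurable_normal_pdf.
rewrite -(Radon_Nikodym_SigmaFinite.change_of_variables nudom)//.
have mRN := Radon_Nikodym_SigmaFinite.f_integrable nudom.
apply: ae_eq_integral => //.
- by apply: emeasurable_funM => //; exact: measurable_int mRN.
- exact: emeasurable_funM.
apply: ae_eqe_mul2l; apply: integral_ae_eq => //.
by move=> A _ mA; rewrite -Radon_Nikodym_SigmaFinite.f_integral.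
Qed.

Lemma normal_prob_mgf (R : realType) (c : R) :
  (\int[normal_prob 0 1]_x (expR (c * x))%:E = (expR (c ^+ 2 / 2))%:E)%E.
Proof.
have mexp : measurable_fun setT (fun x : R => (expR (c * x))%:E).
  by apply/measurable_EFinP; apply: measurableT_comp => //; exact: measurable_funM.
rewrite normal_prob_integral//.
(* Completing the square, c x - x^2/2 = c^2/2 - (x - c)^2/2, turns the integrand into a multiple of
   the density of N(c, 1). *)
transitivity (\int[@lebesgue_measure R]_x
    ((expR (c ^+ 2 / 2))%:E * (normal_pdf c 1 x)%:E))%E.
  apply: eq_integral => x _; rewrite -!EFinM; congr EFin.
  rewrite !normal_pdfE ?oner_neq0// mulrCA [RHS]mulrCA; congr (_ * _).
  by rewrite /normal_fun -!expRD; congr expR; field.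
rewrite ge0_integralZl//=.
- by rewrite integral_normal_pdf mule1.
- by apply/measurable_EFinP; exact: measurable_normal_pdf.
- by move=> x _; rewrite lee_fin normal_pdf_ge0.
Qed.

(** Induction on [s]: [X e] is integrated out first, the rest of the sum being a function of the
    other variables because [e] does not recur in [s]. *)
Lemma gaussian_lincomb_mgf (d : measure_display) (T : measurableType d)
    (R : realType) (P : probability T R) (E : finType) (X : E -> T -> R)
    (c : E -> R) (s : seq E) :
  (forall i, measurable_fun setT (X i)) -> indep P X ->
  (forall i B, measurable B -> P (X i @^-1` B) = normal_prob 0 1 B) ->
  uniq s ->
  (\int[P]_w (expR (\sum_(e <- s) c e * X e w))%:E =
   (expR ((\sum_(e <- s) c e ^+ 2) / 2))%:E)%E.
Proof.
move=> mX iX gX; elim: s => [_|e s ih /= /andP[es us]].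
  under eq_integral do rewrite big_nil expR0.
  by rewrite integral_cst//= probability_setT mule1 big_nil mul0r expR0.
(* The library measure [normal_prob] lives on [measurableTypeR R], whose
   display differs from that of [R]. *)
pose U := measurableTypeR R.
pose XU : E -> T -> U := X.
pose T' := g_sigma_algebraType (cylinders XU e).
(* Zeroing the term at [e] leaves the sum over [s] unchanged and makes every summand measurable for
   [T']. *)
pose h i w := if i == e then 0 else c i * X i w.
have hE w : \sum_(i <- s) c i * X i w = \sum_(i <- s) h i w.
  rewrite big_seq [RHS]big_seq; apply: eq_bigr => i si.
  by rewrite /h; case: eqP => // ie; rewrite -ie si in es.
have mh i : measurable_fun setT (h i : T' -> R).
  rewrite /h; have [ie|ie] := eqVneq i e; first exact: measurable_cst.
  by apply: measurable_funM => //; exact: (@cylinders_measurable_fun _ _ _ U _ XU e i mX ie).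
pose F (z : U * T') := (expR (c e * z.1) * expR (\sum_(i <- s) h i z.2))%:E.
transitivity (\int[P]_w F (X e w, w))%E.
  by apply: eq_integral => w _; rewrite /F big_cons hE expRD.
have mS : measurable_fun setT (fun w : T' => expR (\sum_(i <- s) h i w)).
  by apply: measurableT_comp => //; exact: measurable_sum.
have mF : measurable_fun setT F.
  apply/measurable_EFinP; apply: measurable_funM.
    by apply: measurableT_comp => //; apply: measurable_funM.
  by apply: (measurableT_comp mS); exact: measurable_snd.
pose g : probability (measurableTypeR R) R := normal_prob 0 1.
have F0 z : (0 <= F z)%E by rewrite lee_fin mulr_ge0 ?expR_ge0.
have gXe (B : set U) : measurable B -> P (XU e @^-1` B) = g B by exact: gX.
rewrite (@indep_integral _ _ T U R P E XU e g F mX iX gXe mF F0).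
transitivity (\int[P]_w ((expR (c e ^+ 2 / 2))%:E *
    (expR (\sum_(i <- s) c i * X i w))%:E))%E.
  apply: eq_integral => w _; rewrite hE -normal_prob_mgf -ge0_integralZr//.
  by apply/measurable_EFinP; apply: measurableT_comp => //; exact: measurable_funM.
rewrite ge0_integralZl//=.
- by rewrite ih// -EFinM -expRD big_cons mulrDl.
- apply/measurable_EFinP; apply: measurableT_comp => //; apply: measurable_sum => i.
  exact: measurable_funM.
Qed.

(** Chernoff bound at the parameter s / V, which minimises r^2 V / 2 - r s. *)
Lemma gaussian_lincomb_tail (d : measure_display) (T : measurableType d)
    (R : realType) (P : probability T R) (E : finType) (X : E -> T -> R)
    (c : E -> R) (V s : R) :
  (forall i, measurable_fun setT (X i)) -> indep P X ->
  (forall i B, measurable B -> P (X i @^-1` B) = normal_prob 0 1 B) ->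
  \sum_e c e ^+ 2 <= V -> 0 < V -> 0 < s ->
  (P [set w | (s <= \sum_e c e * X e w)%R] <= (expR (- (s ^+ 2 / (2 * V))))%:E)%E.
Proof.
move=> mX iX gX cV V0 s0.
have mZ : measurable_fun setT (fun w => \sum_e c e * X e w).
  by apply: measurable_sum => i; exact: measurable_funM.
pose Z : {mfun T >-> R} := HB.pack (fun w => \sum_e c e * X e w)
  (isMeasurableFun.Build _ _ _ _ (fun w => \sum_e c e * X e w) mZ).
have r0 : 0 < s / V by rewrite divr_gt0.
apply: le_trans (@chernoff _ _ _ P Z (s / V) s r0) _.
have -> : ('M_P Z (s / V) =
    (expR ((\sum_e (s / V * c e) ^+ 2) / 2))%:E)%E.
  rewrite -(@gaussian_lincomb_mgf _ _ _ P _ X) ?index_enum_uniq//.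
  rewrite /mmt_gen_fun unlock; apply: eq_integral => w _ /=.
  congr (expR _)%:E. rewrite mulr_suml; apply: eq_bigr => i _. by ring.
rewrite -EFinM -expRD lee_fin ler_expR.
under eq_bigr do rewrite exprMn.
rewrite -mulr_sumr.
have : (s / V) ^+ 2 * (\sum_e c e ^+ 2) <= (s / V) ^+ 2 * V.
  by rewrite ler_wpM2l// sqr_ge0.
have -> : (s / V) ^+ 2 * V = s ^+ 2 / V by field; rewrite gt_eqF.
have -> : - (s ^+ 2 / (2 * V)) = (s ^+ 2 / V) / 2 - s / V * s.
  by field; rewrite gt_eqF.
lra.
Qed.

(** Rows are peeled off one at a time. With every entry but (j, i0) frozen, row j is affine in one
    Gaussian with slope [v i0], so it lies in [-t, t] only if that Gaussian lies in an interval of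
    radius t / |v i0|. *)
Lemma gaussian_rows_small_ball (d : measure_display) (T : measurableType d)
    (R : realType) (P : probability T R) (m n : nat)
    (X : 'I_m * 'I_n -> T -> R) (v : 'I_n -> R) (i0 : 'I_n) (t : R)
    (J : seq 'I_m) :
  (forall i, measurable_fun setT (X i)) -> indep P X ->
  (forall i B, measurable B -> P (X i @^-1` B) = normal_prob 0 1 B) ->
  v i0 != 0 -> 0 <= t -> uniq J ->
  measurable [set w | forall j, j \in J -> `|\sum_i v i * X (j, i) w| <= t] /\
  (P [set w | forall j, j \in J -> (`|\sum_i v i * X (j, i) w| <= t)%R]
    <= ((t / `|v i0|) ^+ size J)%:E)%E.
Proof.
move=> mX iX gX v0 t0.
pose K (J : seq 'I_m) := [set w | forall j, j \in J -> `|\sum_i v i * X (j, i) w| <= t].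
have KS j J' : K (j :: J') = [set w | `|\sum_i v i * X (j, i) w| <= t] `&` K J'.
  apply/seteqP; split=> [w h|w [h1 h2] j'].
    by split=> [|j' j'J]; apply: h; rewrite inE ?eqxx// j'J orbT.
  by rewrite inE => /orP[/eqP ->//|]; exact: h2.
have K0 : K [::] = setT by apply/seteqP; split.
have mrow d' (T' : measurableType d') (f : T' -> R) : measurable_fun setT f ->
    measurable [set w | `|f w| <= t].
  move=> mf; have -> : [set w | `|f w| <= t] = setT `&` f @^-1` `[- t, t].
    by rewrite setTI; apply/seteqP; split => w /=; rewrite in_itv/= ler_norml.
  exact: mf.
(* Stated for an arbitrary sigma-algebra, since it is needed both on [T] and on the smaller one that
   omits an entry. *)
have mK d' (T' : measurableType d') (Y : 'I_m -> T' -> R) (J' : seq 'I_m) :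
    (forall j, j \in J' -> measurable_fun setT (Y j)) ->
    measurable [set w | forall j, j \in J' -> `|Y j w| <= t].
  elim: J' => [_|j J' ih mY].
    by rewrite (_ : [set _ | _] = setT)//; apply/seteqP; split.
  rewrite (_ : [set _ | _] = [set w | `|Y j w| <= t] `&`
    [set w | forall j, j \in J' -> `|Y j w| <= t]).
    apply: measurableI; first by apply/mrow/mY; rewrite inE eqxx.
    by apply: ih => j' j'J; apply: mY; rewrite inE j'J orbT.
  apply/seteqP; split=> [w h|w [h1 h2] j'].
    by split=> [|j' j'J]; apply: h; rewrite inE ?eqxx// j'J orbT.
  by rewrite inE => /orP[/eqP ->//|]; exact: h2.
move=> uJ; split.
  by apply: mK => j _; apply: measurable_sum => i; exact: measurable_funM.
rewrite -/(K J); elim: J uJ => [_|j J ih /= /andP[jJ uJ]].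
  by rewrite K0 probability_setT expr0.
pose U := measurableTypeR R.
pose XU : 'I_m * 'I_n -> T -> U := X.
pose e := (j, i0).
pose T' := g_sigma_algebraType (cylinders XU e).
have mXe i : i != e -> measurable_fun setT (X i : T' -> R).
  by move=> ie; exact: (@cylinders_measurable_fun _ _ _ U _ XU e i mX ie).
pose Y (w : T') := \sum_(i | i != i0) v i * X (j, i) w.
have mY : measurable_fun setT Y.
  rewrite /Y (_ : (fun _ => _) = fun w =>
      \sum_i (if i == i0 then 0 else v i * X (j, i) w)); last first.
    apply/funext => w; rewrite big_mkcond/=; apply: eq_bigr => i _.
    by case: eqP.
  apply: measurable_sum => i; have [//|ii0] := eqVneq i i0.
  apply: measurable_funM => //; apply: mXe.
  by apply/eqP => -[]; exact/eqP.
(* As [j] is not in [J], the remaining rows do not involve the entry [e]. *)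
have mKJ : measurable (K J : set T').
  apply: (mK _ T') => j' j'J; apply: measurable_sum => i.
  apply: measurable_funM => //; apply: mXe.
  by apply/eqP => -[j'j _]; rewrite -j'j j'J in jJ.
pose A : set R := `[- t, t]%classic.
pose F (z : U * T') : \bar R := (\1_A (v i0 * z.1 + Y z.2) * \1_(K J) z.2)%:E.
have F0 z : (0 <= F z)%E by rewrite lee_fin mulr_ge0.
have mF : measurable_fun setT F.
  apply/measurable_EFinP; apply: measurable_funM.
    have mA : measurable_fun setT (\1_A : R -> R).
      by apply: measurable_indic; exact: measurable_itv.
    have mL : measurable_fun setT (fun z : U * T' => v i0 * z.1 + Y z.2 : R).
      apply: measurable_funD.
        by apply: measurable_funM => //; exact: measurable_fst.
      by apply: (measurableT_comp mY); exact: measurable_snd.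
    exact: (measurableT_comp mA mL).
  have mI : measurable_fun setT (\1_(K J) : T' -> R) by exact: measurable_indic.
  by apply: (measurableT_comp mI); exact: measurable_snd.
pose g : probability (measurableTypeR R) R := normal_prob 0 1.
have gXe (B : set U) : measurable B -> P (XU e @^-1` B) = g B by exact: gX.
have mKT J' : measurable (K J' : set T).
  by apply: mK => j' _; apply: measurable_sum => i; exact: measurable_funM.
have KA w : (w \in [set w | `|\sum_i v i * X (j, i) w| <= t]) =
    (v i0 * X e w + Y w \in A).
  have rowE : \sum_i v i * X (j, i) w = v i0 * X e w + Y w by rewrite (bigD1 i0).
  by apply/idP/idP; rewrite !in_setE/A/= rowE in_itv/= ler_norml.
have -> : P (K (j :: J)) = (\int[P]_w F (XU e w, w))%E.
  rewrite -[K _]setIT -integral_indic//; apply: eq_integral => w _.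
  by rewrite /F KS indicI; congr (_ * _)%:E; rewrite !indicE KA.
rewrite (@indep_integral _ _ T U R P _ XU e g F mX iX gXe mF F0).
have inner w : (\int[g]_x F (x, w) <= (t / `|v i0|)%:E * (\1_(K J) w)%:E)%E.
  have [wK|wK] := boolP (w \in K J); last first.
    have K0w : \1_(K J) w = 0 :> R by rewrite indicE (negbTE wK).
    by rewrite K0w mule0 integral0_eq// => x _; rewrite /F/= K0w mulr0.
  rewrite indicE wK mule1.
  pose B : set U := (fun x : U => v i0 * x + Y w : R) @^-1` A.
  have mB : measurable B.
    rewrite -[B]setTI; suff: measurable_fun setT (fun x : U => v i0 * x + Y w : R).
      by apply => //; exact: measurable_itv.
    by apply: measurable_funD => //; exact: measurable_funM.
  have -> : (\int[g]_x F (x, w) = g B)%E.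
    rewrite -[B]setIT -integral_indic//; apply: eq_integral => x _.
    by rewrite /F/= !indicE wK mulr1; congr (nat_of_bool _)%:R%:E.
  pose a := - Y w / v i0; pose r := t / `|v i0|.
  have r0 : 0 <= r by rewrite divr_ge0.
  apply: (@le_trans _ _ (g `[a - r, a + r]%classic)).
    apply: le_measure; rewrite ?inE//.
    move=> x; rewrite /B /A/= !in_itv/= -ler_norml -ler_distl => xt.
    have -> : x - a = (v i0 * x + Y w) / v i0 by rewrite /a; field.
    by rewrite normrM normfV ler_pM2r// invr_gt0 normr_gt0.
  have ar : a - r <= a + r by rewrite lerD2l; lra.
  apply: le_trans (normal_prob_itv_le ar) _.
  by rewrite lee_fin /r; lra.
have mG : measurable_fun setT (fun w : T => \int[g]_x F (x, w))%E.
  have mG' : measurable_fun setT (fun w : T' => \int[g]_x F (x, w))%E.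
    exact: measurable_fun_fubini_tonelli_G.
  move=> _ B mB.
  by apply: (cylinders_measurable (X := XU) (e := e) mX); exact: mG'.
apply: (@le_trans _ _ (\int[P]_w ((t / `|v i0|)%:E * (\1_(K J) w)%:E))%E).
  apply: ge0_le_integral => //.
  - by move=> w _; exact: integral_ge0.
  - by apply/measurable_EFinP; apply: measurable_funM.
rewrite ge0_integralZl//.
  rewrite integral_indic// setIT exprS [leRHS]EFinM; apply: lee_wpmul2l; last exact: ih.
  by rewrite lee_fin divr_ge0.
- by apply/measurable_EFinP; exact: measurable_indic.
- by rewrite lee_fin divr_ge0.
Qed.

(** * Union bounds for outer probabilities *)

Lemma prob_le_sub (d : measure_display) (T : measurableType d)
    (P : probability T RR) (E F : set T) (a b : RR) :
  E `<=` F -> a <= b -> prob_le P F a -> prob_le P E b.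
Proof.
move=> EF ab [G [mG FG] PG]; exists G; first by split => // w /EF /FG.
by apply: le_trans PG _; rewrite lee_fin.
Qed.

Lemma prob_leU (d : measure_display) (T : measurableType d)
    (P : probability T RR) (E F : set T) (a b : RR) :
  prob_le P E a -> prob_le P F b -> prob_le P (E `|` F) (a + b).
Proof.
move=> [G [mG EG] PG] [H [mH FH] PH]; exists (G `|` H).
  by split; [exact: measurableU | exact: setUSS].
by apply: le_trans (measureU2 _ mG mH) _; rewrite EFinD leeD.
Qed.

Lemma prob_le_seq (d : measure_display) (T : measurableType d)
    (P : probability T RR) (I : eqType) (s : seq I) (E : I -> set T) (b : RR) :
  (forall i, i \in s -> prob_le P (E i) b) ->
  prob_le P [set w | exists2 i, i \in s & E i w] ((size s)%:R * b).
Proof.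
elim: s => [_|i s ih h].
  by rewrite mul0r; exists set0; [split => // w [] | rewrite measure0].
rewrite /= -natr1 mulrDl mul1r addrC.
apply: (@prob_le_sub _ _ _ _ (E i `|` [set w | exists2 i, i \in s & E i w]) _ _ _ (lexx _)).
  move=> w [j]; rewrite inE => /orP[/eqP -> ?|js ?]; [by left|].
  by right; exists j.
apply: prob_leU; first by apply: h; rewrite inE eqxx.
by apply: ih => j js; apply: h; rewrite inE js orbT.
Qed.

Lemma prob_le_bigcup (d : measure_display) (T : measurableType d)
    (P : probability T RR) (E : nat -> set T) (b : RR) : 0 <= b ->
  (forall i, prob_le P (E i) (b / 2 ^+ i.+1)) -> prob_le P (\bigcup_i E i) b.
Proof.
move=> b0 h.
have /choice[F hF] : forall i, exists F : set T, [/\ measurable F, E i `<=` F &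
    (P F <= (b / 2 ^+ i.+1)%:E)%E].
  by move=> i; have [F [mF EF] PF] := h i; exists F.
exists (\bigcup_i F i).
  split; first by apply: bigcupT_measurable => i; case: (hF i).
  by apply: subset_bigcup => i _; case: (hF i).
apply: le_trans (generalized_Boole_inequality P _ _) _.
- by move=> i; case: (hF i).
- by apply: bigcupT_measurable => i; case: (hF i).
apply: le_trans (epsilon_trick0 xpredT b0).
by apply: lee_nneseries => // i _; case: (hF i) => // _ _; rewrite natrX.
Qed.

Lemma prob_le_ge1 (d : measure_display) (T : measurableType d)
    (P : probability T RR) (E : set T) (b : RR) : 1 <= b -> prob_le P E b.
Proof. by move=> b1; exists setT; [split|rewrite probability_setT lee_fin]. Qed.

Lemma prob_le_measurable (d : measure_display) (T : measurableType d)
    (P : probability T RR) (E : set T) (b : RR) :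
  measurable E -> (P E <= b%:E)%E -> prob_le P E b.
Proof. by move=> mE PE; exists E; first by split. Qed.

(** * Euclidean norm and covers *)

Lemma norm2_sqr (n : nat) (x : 'cV[RR]_n) : norm2 x ^+ 2 = \sum_i (x i 0) ^+ 2.
Proof. by rewrite /norm2 sqr_sqrtr// sumr_ge0// => i _; exact: sqr_ge0. Qed.

Lemma norm2_ge0 (n : nat) (x : 'cV[RR]_n) : 0 <= norm2 x.
Proof. exact: sqrtr_ge0. Qed.

Lemma norm2_entry (n : nat) (x : 'cV[RR]_n) (i : 'I_n) : `|x i 0| <= norm2 x.
Proof.
rewrite -(@ler_pXn2r _ 2)// ?nnegrE ?norm2_ge0//.
rewrite real_normK ?num_real// norm2_sqr (bigD1 i)//= lerDl sumr_ge0// => j _.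
exact: sqr_ge0.
Qed.

Lemma norm2_gt0 (n : nat) (x : 'cV[RR]_n) : x != 0 -> 0 < norm2 x.
Proof.
move=> x0; rewrite lt_neqAle norm2_ge0 andbT eq_sym.
apply: contra x0 => /eqP x0; apply/eqP/matrixP => i j; rewrite ord1 mxE.
by apply/normr0_eq0/eqP; rewrite eq_le normr_ge0 -x0 norm2_entry.
Qed.

Lemma norm2Z (n : nat) (a : RR) (x : 'cV[RR]_n) : norm2 (a *: x) = `|a| * norm2 x.
Proof.
rewrite /norm2; under eq_bigr do rewrite mxE exprMn.
by rewrite -mulr_sumr sqrtrM ?sqr_ge0// sqrtr_sqr.
Qed.

Lemma sphere_proj_norm (n : nat) (X : set 'cV[RR]_n) s : sphere_proj X s -> norm2 s = 1.
Proof.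
move=> [x [_ /eqP x0] <-]; rewrite norm2Z ger0_norm ?invr_ge0 ?norm2_ge0//.
by rewrite mulVf// gt_eqF// norm2_gt0.
Qed.

(** The factor 2 makes the inequality strict, so that a cover can be extracted without the infimum
    being attained. *)
Lemma cover_of_covering_number (n : nat) (S : set 'cV[RR]_n) (e b : RR) :
  0 < b -> (covering_number S e <= b%:E)%E ->
  exists2 c, is_cover S e c & (size c)%:R <= 2 * b.
Proof.
move=> b0 h.
have : (covering_number S e < (2 * b)%:E)%E.
  by apply: le_lt_trans h _; rewrite lte_fin; lra.
rewrite /covering_number => /ereal_inf_lt [_ [c hc <-]].
by rewrite lte_fin => /ltW ?; exists c.
Qed.

(** * Chaining for a Gaussian process *)

(** For independent standard Gaussian entries of [B] this is a centred Gaussian with variance |f|^2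
    |v|^2. *)
Definition pairing {m n : nat} (f : 'I_m -> RR) (B : 'M[RR]_(m, n)) (v : 'cV[RR]_n) : RR :=
  \sum_j f j * (B *m v) j 0.

Definition gaussian_entries {d : measure_display} {T : measurableType d}
    (P : probability T RR) {m n : nat} (A : 'I_m -> 'I_n -> T -> RR) : Prop :=
  [/\ forall e : 'I_m * 'I_n, measurable_fun setT (A e.1 e.2 : T -> (RR : realType)),
      @indep _ _ T (RR : realType) RR P _ (fun e : 'I_m * 'I_n => A e.1 e.2) &
      forall (e : 'I_m * 'I_n) (B : set (RR : realType)), measurable B ->
        P (A e.1 e.2 @^-1` B) = normal_prob 0 1 B].

Lemma pairing_sum (d : measure_display) (T : measurableType d) (m n : nat)
    (A : 'I_m -> 'I_n -> T -> RR) (f : 'I_m -> RR) (v : 'cV[RR]_n) (w : T) :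
  pairing f (rmatrix A w) v =
  \sum_(e : 'I_m * 'I_n) f e.1 * v e.2 0 * A e.1 e.2 w.
Proof.
rewrite -(pair_bigA _ (fun j i => f j * v i 0 * A j i w))/=.
apply: eq_bigr => j _; rewrite mxE mulr_sumr; apply: eq_bigr => i _.
by rewrite mxE; ring.
Qed.

Lemma pairingB (m n : nat) (f : 'I_m -> RR) (B : 'M[RR]_(m, n)) (v w : 'cV[RR]_n) :
  pairing f B (v - w) = pairing f B v - pairing f B w.
Proof.
rewrite /pairing -sumrB; apply: eq_bigr => j _.
by rewrite mulmxBr !mxE mulrBr.
Qed.

(** A crude Lipschitz bound for fixed [B]. Its constant may be large, since it only serves to pass
    from the nets to all of [S] in the limit. *)
Lemma pairing_le (m n : nat) (f : 'I_m -> RR) (B : 'M[RR]_(m, n)) (v : 'cV[RR]_n) :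
  pairing f B v <= (\sum_j \sum_i `|f j * B j i|) * norm2 v.
Proof.
rewrite mulr_suml; apply: ler_sum => j _; rewrite mxE mulr_sumr mulr_suml.
apply: ler_sum => i _; rewrite mulrA; apply: le_trans (ler_norm _) _.
by rewrite normrM ler_wpM2l// norm2_entry.
Qed.

Lemma pairing_tail (d : measure_display) (T : measurableType d)
    (P : probability T RR) (m n : nat) (A : 'I_m -> 'I_n -> T -> RR)
    (f : 'I_m -> RR) (v : 'cV[RR]_n) (V a s : RR) :
  gaussian_entries P A -> \sum_j f j ^+ 2 <= V -> norm2 v <= a ->
  0 < V -> 0 < a -> 0 < s ->
  prob_le P [set w | s <= pairing f (rmatrix A w) v]
    (expR (- (s ^+ 2 / (2 * (V * a ^+ 2))))).
Proof.
move=> [mA iA gA] fV va V0 a0 s0.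
have -> : [set w | s <= pairing f (rmatrix A w) v] =
    [set w | s <= \sum_(e : 'I_m * 'I_n) f e.1 * v e.2 0 * A e.1 e.2 w].
  by apply/seteqP; split => w /=; rewrite pairing_sum.
apply: prob_le_measurable.
  have mS : measurable_fun setT
      (fun w : T => \sum_(e : 'I_m * 'I_n) f e.1 * v e.2 0 * A e.1 e.2 w : (RR : realType)).
    by apply: measurable_sum => e; exact: measurable_funM.
  have -> : [set w | s <= \sum_(e : 'I_m * 'I_n) f e.1 * v e.2 0 * A e.1 e.2 w] =
    setT `&` (fun w : T => \sum_(e : 'I_m * 'I_n) f e.1 * v e.2 0 * A e.1 e.2 w : (RR : realType))
      @^-1` `[s, +oo[.
    by rewrite setTI; apply/seteqP; split => w /=; rewrite in_itv/= andbT.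
  by apply: mS => //; exact: measurable_itv.
apply: (@gaussian_lincomb_tail _ _ (RR : realType) P _ _
  (fun e : 'I_m * 'I_n => f e.1 * v e.2 0) _ _ mA iA gA) => //; last first.
  by rewrite mulr_gt0// exprn_gt0.
rewrite -(pair_bigA _ (fun j i => (f j * v i 0) ^+ 2))/=.
have -> : \sum_j \sum_i (f j * v i 0) ^+ 2 = (\sum_j f j ^+ 2) * norm2 v ^+ 2.
  rewrite norm2_sqr mulr_suml; apply: eq_bigr => j _; rewrite mulr_sumr.
  by apply: eq_bigr => i _; rewrite exprMn.
apply: ler_pM => //; rewrite ?sqr_ge0 ?sumr_ge0//.
  by move=> j _; exact: sqr_ge0.
by rewrite ler_pXn2r// nnegrE ?norm2_ge0// ltW.
Qed.

(** Along a chain of net points the allowed increments sum to less than [theta]; continuity in s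
    extends the bound from the nets to [S]. *)
Lemma chaining_bound (m n : nat) (f : 'I_m -> RR) (B : 'M[RR]_(m, n))
    (S : set 'cV[RR]_n) (c : nat -> seq 'cV[RR]_n)
    (D : nat -> 'cV[RR]_n -> 'cV[RR]_n) (q theta : RR) :
  0 < q -> q < 1 / 2 -> 0 < theta ->
  (forall i, is_cover S (q ^+ i.+1) (c i)) ->
  (forall y, D 0%N y = y) ->
  (forall i y, y \in c i.+1 -> y - D i.+1 y \in c i) ->
  (forall i y, y \in c i ->
     pairing f B (D i y) < theta * (1 - 2 * q) * (2 * q) ^+ i) ->
  forall s, S s -> pairing f B s <= theta.
Proof.
move=> q0 q1 t0 cS D0 DS hD s Ss.
(* The geometric sum of theta (1 - 2q) (2q)^j over j <= i is theta (1 - (2q)^(i+1)). *)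
have hc i y : y \in c i -> pairing f B y < theta * (1 - (2 * q) ^+ i.+1).
  elim: i y => [y yc|i ih y yc].
    by have := hD _ _ yc; rewrite D0 expr0 mulr1 expr1.
  have h1 := hD _ _ yc; have h2 := ih _ (DS _ _ yc).
  have -> : pairing f B y = pairing f B (y - D i.+1 y) + pairing f B (D i.+1 y).
    by rewrite pairingB subrK.
  rewrite (exprS _ i.+1); move: h1 h2; set t := (2 * q) ^+ i.+1; lra.
have [//|lt] := leP (pairing f B s) theta; exfalso.
pose L := \sum_j \sum_i `|f j * B j i|.
have L0 : 0 <= L by apply: sumr_ge0 => j _; exact: sumr_ge0.
pose g := pairing f B s - theta.
have g0 : 0 < g by rewrite subr_gt0.
have [K hK] : exists K : nat, L / g < K%:R.
  by exists (Num.bound (L / g)); apply: archi_boundP; rewrite divr_ge0// ltW.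
have [y yc sy] := (cS K).2 _ Ss.
(* From K <= 2^(K+1) and 2q < 1 follows L q^(K+1) <= L / K < g, whereas the net point at level K
   forces g < L q^(K+1). *)
have qK : q ^+ K.+1 * K%:R <= 1.
  apply: (@le_trans _ _ (q ^+ K.+1 * 2 ^+ K.+1)).
    rewrite ler_wpM2l ?exprn_ge0 ?(ltW q0)//.
    by rewrite -natrX ler_nat ltnW// (leq_trans _ (ltn_expl K.+1 (ltnSn 1))).
  by rewrite -exprMn exprn_ile1//; lra.
have h1 := hc _ _ yc.
have h2 : pairing f B (s - y) <= L * q ^+ K.+1.
  by apply: le_trans (pairing_le _ _ _) _; rewrite ler_wpM2l.
rewrite pairingB in h2.
have h3 : theta * (1 - (2 * q) ^+ K.+1) <= theta.
  rewrite ger_pMr// gerBl exprn_ge0//; lra.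
have h4 : g < L * q ^+ K.+1 by rewrite /g; lra.
have : L < K%:R * g by rewrite -ltr_pdivrMr.
have qK0 : 0 < q ^+ K.+1 by rewrite exprn_gt0.
have : L * q ^+ K.+1 * K%:R <= L by rewrite -mulrA ler_piMr.
have K0 : 0 <= K%:R :> RR by [].
have : K%:R * g <= K%:R * (L * q ^+ K.+1) by rewrite ler_wpM2l// ltW.
rewrite [K%:R * (L * _)]mulrC; lra.
Qed.

(** [D i y] is the difference between [y] and its parent in the previous net. *)
Lemma chaining_increments (n : nat) (S : set 'cV[RR]_n)
    (c : nat -> seq 'cV[RR]_n) (q : RR) :
  (forall i, is_cover S (q ^+ i.+1) (c i)) ->
  (forall s, S s -> norm2 s <= 1) ->
  exists D : nat -> 'cV[RR]_n -> 'cV[RR]_n,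
    [/\ forall y, D 0%N y = y,
        forall i y, y \in c i.+1 -> y - D i.+1 y \in c i &
        forall i y, y \in c i -> norm2 (D i y) <= q ^+ i].
Proof.
move=> cS S1.
(* Off the net the parent is the dummy value [y], which makes the choice total. *)
have /choice[par hpar] : forall z : nat * 'cV[RR]_n, exists p, z.2 \in c z.1.+1 ->
    p \in c z.1 /\ norm2 (z.2 - p) <= q ^+ z.1.+1.
  move=> [i y] /=; have [yc|nyc] := boolP (y \in c i.+1); last by exists y.
  by have [p pc yp] := (cS i).2 _ ((cS i.+1).1 _ yc); exists p.
(* The increment at the root is [y] itself, of norm at most 1 = q^0. *)
exists (fun i y => if i is j.+1 then y - par (j, y) else y); split=> //.
- by move=> i y yc; rewrite opprB addrC subrK; case: (hpar (i, y) yc).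
- case=> [|i] y yc; first by rewrite expr0; apply: S1; exact: (cS 0%N).1.
  by case: (hpar (i, y) yc).
Qed.

(** Union bound over all levels, net points and indices in [I]. In the exponent (1 + H + 2C) m, the
    1 pays for the nets and H for [I]; of 2C, one half remains as the final rate and the other
    absorbs the extra 1 in m + 1 and makes the levels summable. *)
Lemma chaining_prob (d : measure_display) (T : measurableType d)
    (P : probability T RR) (m n : nat) (A : 'I_m -> 'I_n -> T -> RR)
    (I : finType) (f : I -> 'I_m -> RR) (V theta : I -> RR)
    (S : set 'cV[RR]_n) (c : nat -> seq 'cV[RR]_n) (q H C : RR) :
  gaussian_entries P A ->
  0 < q -> q < 1 / 2 -> 0 <= H -> 1 <= C * m%:R ->
  (forall i, is_cover S (q ^+ i.+1) (c i)) ->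
  (forall i, (size (c i))%:R <= 2 * @expR RR (i.+1%:R * (m%:R + 1))) ->
  (forall s, S s -> norm2 s <= 1) ->
  #|I|%:R <= expR (H * m%:R) ->
  (forall k, 0 < V k) -> (forall k, 0 < theta k) ->
  (forall k, \sum_j f k j ^+ 2 <= V k) ->
  (forall k, (1 + H + 2 * C) * m%:R <= (theta k * (1 - 2 * q)) ^+ 2 / (2 * V k)) ->
  prob_le P [set w | exists k s, S s /\ theta k < pairing (f k) (rmatrix A w) s]
    (4 * expR (- (C * m%:R))).
Proof.
move=> gA q0 q1 H0 Cm cS sz S1 cardI V0 t0 fV hth.
have [D [D0 DS Dn]] := chaining_increments cS S1.
(* The levels sum to [theta k]; they decay like (2 q)^i while the increments
   decay like q^i, so the Gaussian exponent grows like 4^i and beats the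
   number of points. *)
pose lev k i := theta k * (1 - 2 * q) * (2 * q) ^+ i.
pose Bad i := [set w | exists2 z, z \in [seq (y, k) | y <- c i, k <- enum I] &
   lev z.2 i <= pairing (f z.2) (rmatrix A w) (D i z.1)].
apply: (@prob_le_sub _ _ _ _ (\bigcup_i Bad i) _ _ _ (lexx _)).
  move=> w [k [s [Ss lt]]]; apply: contrapT => nB.
  have : pairing (f k) (rmatrix A w) s <= theta k.
    apply: (chaining_bound q0 q1 (t0 k) cS D0 DS _ Ss) => i y yc.
    rewrite ltNge; apply/negP => h; apply: nB; exists i => //; exists (y, k) => //.
    by apply/allpairsP; exists (y, k); rewrite mem_enum.
  by rewrite leNgt lt.
have q21 : 0 < 1 - 2 * q by lra.
apply: prob_le_bigcup => [|i]; first by rewrite mulr_ge0// expR_ge0.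
(* The Gaussian exponent carries the factor 4^i; its lower bound i + 1 already matches the growth of
   the nets. *)
pose b := @expR RR (- (i.+1%:R * ((1 + H + 2 * C) * m%:R))).
apply: (@prob_le_sub _ _ _ _ _ ((size [seq (y, k) | y <- c i, k <- enum I])%:R * b) _ _ _
  (prob_le_seq (E := fun z => [set w | lev z.2 i <= pairing (f z.2) (rmatrix A w) (D i z.1)]) _)).
- by [].
- rewrite size_allpairs -cardE natrM.
  apply: (@le_trans _ _ (2 * @expR RR (i.+1%:R * (m%:R + 1)) * expR (H * m%:R) * b)).
    by rewrite ler_wpM2r ?expR_ge0// ler_pM.
  rewrite /b -!mulrA -!expRD.
  apply: (@le_trans _ _ (2 * (expR (- (C * m%:R)) * expR (- i%:R)))).
    rewrite ler_wpM2l// -expRD ler_expR.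
    have i0 : 0 <= i%:R :> RR by [].
    rewrite -natr1; set x := i%:R in i0 *; set M := m%:R in Cm *.
    (* The difference of the two exponents is exactly the sum of this term and the next one. *)
    have : 0 <= (2 * x + 1) * (C * M - 1) by rewrite mulr_ge0; lra.
    have : 0 <= x * (H * M) by rewrite !mulr_ge0.
    lra.
  have e2 : @expR RR (- i%:R) <= (2 ^+ i)^-1.
    rewrite expRN lef_pV2 ?posrE ?expR_gt0 ?exprn_gt0//.
    rewrite -[i%:R]mulr1 expRM_natl; apply: lerXn2r; rewrite ?nnegrE ?expR_ge0//.
    by have := expR_ge1Dx (1 : (RR : realType)); lra.
  have -> : 4 * (expR (- (C * m%:R)) / 2 ^+ i.+1) = 2 * (expR (- (C * m%:R)) / 2 ^+ i).
    by rewrite exprS; field; rewrite expf_neq0.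
  by rewrite !ler_wpM2l// expR_ge0.
move=> [y k] /allpairsP [[y' k'] /= [yc _ [-> ->]]] {y k}.
have qi : 0 < q ^+ i by rewrite exprn_gt0.
have lev0 : 0 < lev k' i by rewrite /lev !mulr_gt0// exprn_gt0// mulr_gt0.
apply: (prob_le_sub _ _ (pairing_tail gA (fV k') (Dn _ _ yc) (V0 k') qi lev0)) => //.
rewrite /b ler_expR lerN2 /lev.
have qi0 : q ^+ i != 0 by rewrite expf_neq0// gt_eqF.
have Vk0 : V k' != 0 by rewrite gt_eqF.
have -> : (theta k' * (1 - 2 * q) * (2 * q) ^+ i) ^+ 2 / (2 * (V k' * (q ^+ i) ^+ 2)) =
    4 ^+ i * ((theta k' * (1 - 2 * q)) ^+ 2 / (2 * V k')).
  have -> : (4 : RR) = 2 * 2 by rewrite -natrM.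
  rewrite !exprMn; set u := q ^+ i in qi0 *; set t := 2 ^+ i; field.
  by rewrite qi0 Vk0.
apply: ler_pM => //; rewrite -?natrX ?ler_nat.
  have HM : 0 <= H * m%:R by rewrite mulr_ge0.
  have : 0 <= m%:R :> RR by [].
  lra.
by rewrite ltn_expl.
Qed.

(** * Numerical constants and the choice of scales *)

(** Starting from 1 + x <= e^x at x = 1/100, one takes powers repeatedly and rounds down to small
    fractions. The first two bounds count the vectors in {-1,1}^m and {-1,0,1}^m; the last two bound
    the scale q. *)
Lemma expR_numerics (R : realType) :
  [/\ 2 <= expR (7 / 10) :> R, 3 <= expR (6 / 5) :> R,
      expR (- (18 / 5)) <= 1 / 35 :> R & expR (- 2) <= 1 / 7 :> R].
Proof.
have pow (x y a b : R) (n : nat) : 0 <= a -> a <= expR x -> b <= a ^+ n ->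
    y = n%:R * x -> b <= expR y.
  move=> a0 ax ba ->; rewrite expRM_natl; apply: le_trans ba _.
  by apply: lerXn2r; rewrite ?nnegrE ?expR_ge0.
have h1 : 101 / 100 <= expR (1 / 100) :> R by apply: le_trans (expR_ge1Dx _); lra.
have h5 : 165 / 157 <= expR (1 / 20) :> R by apply: (pow _ _ _ _ 5 _ h1); lra.
have h10 : 74 / 67 <= expR (1 / 10) :> R by apply: (pow _ _ _ _ 2 _ h5); lra.
have h20 : 50 / 41 <= expR (1 / 5) :> R by apply: (pow _ _ _ _ 2 _ h10); lra.
have h60 : 29 / 16 <= expR (3 / 5) :> R by apply: (pow _ _ _ _ 3 _ h20); lra.
have h180 : 71 / 12 <= expR (9 / 5) :> R by apply: (pow _ _ _ _ 3 _ h60); lra.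
split.
- have -> : 7 / 10 = 3 / 5 + 1 / 10 :> R by lra.
  rewrite expRD; apply: (@le_trans _ _ (29 / 16 * (74 / 67))); first by lra.
  by apply: ler_pM; lra.
- by apply: (pow _ _ _ _ 2 _ h60); lra.
- rewrite expRN div1r lef_pV2 ?posrE ?expR_gt0//.
  by apply: (pow _ _ _ _ 2 _ h180); lra.
- rewrite expRN div1r lef_pV2 ?posrE ?expR_gt0//.
  have -> : 2 = 9 / 5 + 1 / 5 :> R by lra.
  rewrite expRD; apply: (@le_trans _ _ (71 / 12 * (50 / 41))); first by lra.
  by apply: ler_pM; lra.
Qed.

(** For k > 0 take q = e^(-(M+1)/k), so that q^-k = e^(M+1) exactly. The bound on k ln (1/e) gives q
    < e, strictly thanks to the extra 1, and the bound on k a gives q <= e^-a <= q0. *)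
Lemma scale_choice (R : realType) (k e M q0 a : R) :
  0 < e -> e < 1 / 2 -> 0 <= M -> k * ln (1 / e) <= M ->
  0 < q0 -> expR (- a) <= q0 -> k * a <= M + 1 ->
  exists q, [/\ 0 < q, q < e, q <= q0 & q `^ (- k) <= expR (M + 1)].
Proof.
move=> e0 e12 M0 ke q00 aq ka.
have [k0|k0] := ltP 0 k.
  exists (expR (- ((M + 1) / k))); split.
  - exact: expR_gt0.
  - rewrite -[ltRHS]lnK ?posrE// ltr_expR.
    rewrite div1r lnV ?posrE// mulrN in ke.
    rewrite ltrNl ltr_pdivlMr//; lra.
  - apply: le_trans aq; rewrite ler_expR lerN2 ler_pdivlMr//; lra.
  - rewrite -expRM ler_expR mulrNN divfK//; exact: lt0r_neq0.
(* For k <= 0 any scale below 1 has q^-k <= 1. *)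
exists (Num.min (e / 2) q0); split.
- by rewrite lt_min; apply/andP; split; lra.
- by rewrite gt_min; apply/orP; left; lra.
- by rewrite ge_min lexx orbT.
- apply: (@le_trans _ _ 1); last first.
    by rewrite -[leLHS]expR0 ler_expR; lra.
  rewrite -[leRHS](powRr0 (Num.min (e / 2) q0)); apply: ger_powR; last by lra.
  rewrite lt_min ge_min; apply/andP; split; first by apply/andP; split; lra.
  by apply/orP; left; lra.
Qed.

Lemma scale_covers (n : nat) (S : set 'cV[RR]_n) (k e q M : RR) :
  0 < q -> q < e -> q <= 1 -> q `^ (- k) <= expR (M + 1) ->
  (forall x : RR, 0 < x -> x < e -> (covering_number S x <= (x `^ (- k))%:E)%E) ->
  exists c : nat -> seq 'cV[RR]_n,
    (forall i, is_cover S (q ^+ i.+1) (c i)) /\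
    (forall i, (size (c i))%:R <= 2 * expR (i.+1%:R * (M + 1))).
Proof.
move=> q0 qe q1 qk hS.
suff /choice[c hc] : forall i, exists c : seq 'cV[RR]_n, is_cover S (q ^+ i.+1) c /\
    (size c)%:R <= 2 * expR (i.+1%:R * (M + 1)).
  by exists c; split=> i; case: (hc i).
move=> i.
have qi0 : 0 < q ^+ i.+1 by rewrite exprn_gt0.
have qie : q ^+ i.+1 < e.
  by apply: le_lt_trans qe; rewrite exprS ger_pMr// exprn_ile1// ltW.
have h := hS _ qi0 qie.
have [c cS sc] := cover_of_covering_number (powR_gt0 (- k) qi0) h.
exists c; split => //; apply: le_trans sc _; rewrite ler_wpM2l//.
have -> : (q ^+ i.+1) `^ (- k) = (q `^ (- k)) ^+ i.+1.
  by rewrite -(powR_mulrn i.+1 (ltW q0)) -powRrM -(powR_mulrn _ (powR_ge0 q (- k))) -powRrM mulrC.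
by rewrite expRM_natl; apply: lerXn2r; rewrite ?nnegrE ?expR_ge0 ?powR_ge0.
Qed.

(** * The saturation event *)

(** Each clipped coordinate contributes at least mu to the pairing with x and the others are
    nonnegative; dividing by |x| < r < mu tau gives the strict bound. *)
Lemma clipped_pairing (m n : nat) (mu tau r : RR) (X : set 'cV[RR]_n)
    (B : 'M[RR]_(m, n)) (f : 'I_m -> RR) (x : 'cV[RR]_n) :
  0 < mu -> 0 < tau -> r < mu * tau -> ball_part X r x ->
  (0 < #|[pred j | (mu <= `|(B *m x) j 0|)%R]|)%N ->
  (forall j, (if mu <= `|(B *m x) j 0| then mu else 0) <= f j * (B *m x) j 0) ->
  exists2 s, sphere_proj X s &
    #|[pred j | (mu <= `|(B *m x) j 0|)%R]|%:R / tau < pairing f B s.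
Proof.
move=> mu0 tau0 rmu [Xx xr] l0 hf.
set l := #|_| in l0 *.
have x0 : x != 0.
  apply/eqP => x0; case/card_gt0P: l0 => j; rewrite inE x0 mulmx0 mxE normr0.
  by rewrite leNgt mu0.
have nx := norm2_gt0 x0.
exists ((norm2 x)^-1 *: x); first by exists x => //; split => //; exact/eqP.
have -> : pairing f B ((norm2 x)^-1 *: x) = pairing f B x / norm2 x.
  rewrite /pairing mulr_suml; apply: eq_bigr => j _.
  by rewrite -scalemxAr mxE; ring.
have : l%:R * mu <= pairing f B x.
  apply: le_trans (ler_sum _ (fun j _ => hf j)).
  by rewrite -big_mkcond/= sumr_const mulr_natl.
move=> h; rewrite ltr_pdivlMr// mulrAC ltr_pdivrMr//.
have lp : 0 < l%:R :> RR by rewrite ltr0n.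
apply: (@lt_le_trans _ _ (l%:R * mu * tau)); last by rewrite ler_wpM2r// ltW.
by rewrite -mulrA ltr_pM2l//; lra.
Qed.

(** The part common to both ranges of tau, for a finite family [f] from which every sufficiently
    clipped vector can select its signs. The numerical condition is stated at [q0] and passes to the
    actual q <= q0, because 1 - 2q only increases. *)
Lemma saturation_prob_of (d : measure_display) (T : measurableType d)
    (P : probability T RR) (m n : nat) (A : 'I_m -> 'I_n -> T -> RR)
    (mu k epsS r q0 a H : RR) (X : set 'cV[RR]_n)
    (I : finType) (f : I -> 'I_m -> RR) (V theta : I -> RR) :
  let tau := 1 / 2 - (k + 1) / m%:R in
  gaussian_entries P A -> 0 < mu -> 0 < epsS -> epsS < 1 / 2 ->
  (forall e : RR, 0 < e -> e < epsS ->
     (covering_number (sphere_proj X) e <= (e `^ (- k))%:E)%E) ->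
  k * ln (1 / epsS) <= m%:R -> 0 < r -> r < mu * tau -> 1 <= 1 / 30 * m%:R :> RR ->
  0 < q0 -> q0 < 1 / 2 -> expR (- a) <= q0 -> k * a <= m%:R + 1 -> 0 <= H ->
  #|I|%:R <= expR (H * m%:R) ->
  (forall i, 0 < V i) -> (forall i, 0 < theta i) ->
  (forall i, \sum_j f i j ^+ 2 <= V i) ->
  (forall i, (1 + H + 2 * (1 / 30)) * m%:R <=
     (theta i * (1 - 2 * q0)) ^+ 2 / (2 * V i)) ->
  (forall (y : 'cV[RR]_m), m%:R * (2 * tau) <= #|[pred j | (mu <= `|y j 0|)%R]|%:R :> RR ->
     exists i, theta i <= #|[pred j | (mu <= `|y j 0|)%R]|%:R / tau /\
     forall j, (if mu <= `|y j 0| then mu else 0) <= f i j * y j 0) ->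
  prob_le P [set w | exists2 x, ball_part X r x &
      m%:R * (2 * tau) <= #|[pred j | (mu <= `|(rmatrix A w *m x) j 0|)%R]|%:R :> RR]
    (4 * expR (- (1 / 30 * m%:R))).
Proof.
move=> tau gA mu0 e0 e12 hS ke r0 rmu Cm q00 q01 aq ka H0 cI V0 t0 fV hth hsel.
have m0 : 0 < m%:R :> RR by lra.
have tau0 : 0 < tau by rewrite -(pmulr_rgt0 _ mu0); lra.
have [q [qp qe qq0 qk]] := scale_choice e0 e12 (ltW m0) ke q00 aq ka.
have q1 : q <= 1 by lra.
have [c [cS sc]] := scale_covers qp qe q1 qk hS.
apply: (prob_le_sub _ _ (chaining_prob (f := f) (V := V) (theta := theta) gA
  qp _ H0 Cm cS sc _ cI V0 t0 fV _)) => //; last 3 first.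
- by lra.
- by move=> s /sphere_proj_norm ->.
- move=> i; apply: le_trans (hth i) _.
  rewrite ler_wpM2r ?invr_ge0 ?mulr_ge0 ?(ltW (V0 i))//.
  apply: lerXn2r; rewrite ?nnegrE ?mulr_ge0 ?(ltW (t0 i))//; try lra.
  by rewrite ler_wpM2l ?(ltW (t0 i))//; lra.
move=> w [x xX hx].
have [i [hi hf]] := hsel _ hx.
exists i.
have [|s Ss hs] := clipped_pairing mu0 tau0 rmu xX _ hf.
  by rewrite -(ltr0n RR); apply: lt_le_trans hx; rewrite !mulr_gt0.
by exists s; split => //; exact: le_lt_trans hs.
Qed.

Lemma saturation_prob (d : measure_display) (T : measurableType d)
    (P : probability T RR) (m n : nat) (A : 'I_m -> 'I_n -> T -> RR)
    (mu k epsS r : RR) (X : set 'cV[RR]_n) :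
  let tau := 1 / 2 - (k + 1) / m%:R in
  gaussian_entries P A -> 0 < mu -> 0 < epsS -> epsS < 1 / 2 ->
  (forall e : RR, 0 < e -> e < epsS ->
     (covering_number (sphere_proj X) e <= (e `^ (- k))%:E)%E) ->
  k * ln (1 / epsS) <= m%:R -> 0 < r -> r < mu * tau -> 1 <= 1 / 30 * m%:R :> RR ->
  prob_le P [set w | exists2 x, ball_part X r x &
      m%:R * (2 * tau) <= #|[pred j | (mu <= `|(rmatrix A w *m x) j 0|)%R]|%:R :> RR]
    (4 * expR (- (1 / 30 * m%:R))).
Proof.
move=> tau gA mu0 e0 e12 hS ke r0 rmu Cm.
have m0 : 0 < m%:R :> RR by lra.
have tau0 : 0 < tau by rewrite -(pmulr_rgt0 _ mu0); lra.
have [e2 e3 e18 e27] := expR_numerics (RR : realType).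
have sgn (b : bool) (y : RR) : b = (y < 0) -> (-1) ^+ b * y = `|y|.
  move=> ->; case: ltP => h; first by rewrite expr1 mulN1r ltr0_norm.
  by rewrite expr0 mul1r ger0_norm.
have kE : k + 1 = m%:R * (1 / 2 - tau) by rewrite /tau; field; rewrite gt_eqF.
have [tau29|tau29] := ltP (2 / 9) tau.
  (* Here k + 1 <= (1/2 - 2/9) m = (5/18) m, which is why q may be taken as small as e^(-18/5). *)
  have kb : k * (18 / 5) <= m%:R + 1.
    have : m%:R * (1 / 2 - tau) <= m%:R * (5 / 18) by rewrite ler_wpM2l ?ltW//; lra.
    rewrite -kE; lra.
  (* With 2^m <= e^(7m/10) sign vectors, the condition on theta = 2m reads 53/30 <= 2 (33/35)^2. *)
  apply: (@saturation_prob_of _ _ _ _ _ _ mu k epsS r (1 / 35) (18 / 5) (7 / 10) X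
    {ffun 'I_m -> bool} (fun b j => (-1) ^+ b j) (fun=> m%:R) (fun=> 2 * m%:R)) => //.
  - by lra.
  - by rewrite card_ffun card_bool card_ord natrX [_ * m%:R]mulrC expRM_natl
       lerXn2r ?nnegrE ?expR_ge0.
  - by move=> _; rewrite mulr_gt0.
  - move=> b; under eq_bigr do rewrite sqrr_sign.
    by rewrite sumr_const card_ord.
  - move=> _; have -> : (2 * m%:R * (1 - 2 * (1 / 35))) ^+ 2 / (2 * m%:R) =
      2 * (33 / 35) ^+ 2 * m%:R :> RR by field; rewrite gt_eqF.
    by rewrite ler_wpM2r ?(ltW m0)//; lra.
  - move=> y hy; exists [ffun j => y j 0 < 0]; split.
      by rewrite ler_pdivlMr//; lra.
    by move=> j; rewrite ffunE sgn//; case: ifP.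
(* Now only k + 1 <= m/2 is available, hence the coarser scale e^(-2). *)
have kb : k * 2 <= m%:R + 1.
  have : m%:R * (1 / 2 - tau) <= m%:R * (1 / 2) by rewrite ler_wpM2l ?ltW//; lra.
  rewrite -kE; lra.
pose f (b : {ffun 'I_m -> option bool}) j : RR := if b j is Some s then (-1) ^+ s else 0.
pose supp (b : {ffun 'I_m -> option bool}) := \sum_j f b j ^+ 2.
(* The maximum makes the bounds hold also for sign vectors of small support,
   which are never used. *)
pose V b := Num.max (supp b) (m%:R * (2 * tau)).
have V0 b : 0 < V b by rewrite lt_max !mulr_gt0 ?orbT.
apply: (@saturation_prob_of _ _ _ _ _ _ mu k epsS r (1 / 7) 2 (6 / 5) X
    _ f V (fun b => V b / tau)) => //.
- by lra.
- by rewrite card_ffun card_option card_bool card_ord natrX [_ * m%:R]mulrC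
     expRM_natl lerXn2r ?nnegrE ?expR_ge0.
- by move=> b; rewrite divr_gt0.
- by move=> b; rewrite /V le_max lexx.
- move=> b; have Vb := V0 b.
  (* Since V >= 2 tau m and tau <= 2/9, this is at least (225/98) m, above the required 34/15 m. *)
  have -> : (V b / tau * (1 - 2 * (1 / 7))) ^+ 2 / (2 * V b) =
      V b * (25 / 98) / tau ^+ 2 by field; rewrite !gt_eqF.
  rewrite ler_pdivlMr ?exprn_gt0//.
  have h1 : m%:R * (2 * tau) <= V b by rewrite /V le_max lexx orbT.
  have h3 : 0 < m%:R * tau by rewrite mulr_gt0.
  have h2 : m%:R * tau * tau <= m%:R * tau * (2 / 9) by rewrite ler_wpM2l// ltW.
  rewrite expr2; lra.
- move=> y hy.
  pose b : {ffun 'I_m -> option bool} :=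
    [ffun j => if mu <= `|y j 0| then Some (y j 0 < 0) else None].
  exists b; split.
    rewrite ler_wpM2r ?invr_ge0 ?(ltW tau0)// /V ge_max hy andbT.
    rewrite /supp -sum1_card natr_sum [leRHS]big_mkcond/= ler_sum// => j _.
    by rewrite /f ffunE inE; case: ifP => _; rewrite ?sqrr_sign ?expr0n.
  by move=> j; rewrite /f ffunE; case: ifP => h; rewrite ?mul0r// sgn.
Qed.

(** * The collision event *)

(** The net is a product of the directions in [c] with the radii e l for l <= r/e; the radius is
    what raises the exponent from k to k + 1. *)
Lemma ball_part_cover (n : nat) (X : set 'cV[RR]_n) (r e : RR) (c : seq 'cV[RR]_n) :
  0 < e -> 0 < r -> is_cover (sphere_proj X) e c ->
  exists2 Y : seq 'cV[RR]_n, (size Y)%:R <= (size c)%:R * (r / e + 1) &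
    sphere_proj X !=set0 -> forall x, ball_part X r x ->
      exists2 y, y \in Y & forall i, `|x i 0 - y i 0| <= (1 + r) * e.
Proof.
move=> e0 r0 [_ hc].
pose L := (Num.truncn (r / e)).+1.
exists [seq (e * l%:R) *: p | p <- c, l <- iota 0 L].
  rewrite size_allpairs size_iota natrM ler_wpM2l// /L -natr1 lerD2r.
  by have /andP[] := truncn_itv (ltW (divr_gt0 r0 e0)).
move=> [s0 Ss0] x [Xx xr].
(* The origin has no direction and is approximated by radius 0 along any centre, so [c] must be
   nonempty. *)
have [x0|x0] := eqVneq x 0.
  have [p pc _] := hc _ Ss0.
  exists ((e * 0%:R) *: p).
    by apply/allpairsP; exists (p, 0%N); split => //=; rewrite mem_iota.
  move=> i; rewrite x0 !mxE mulr0 mul0r subr0 normr0 mulr_ge0//; lra.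
have nx := norm2_gt0 x0.
set s := (norm2 x)^-1 *: x.
have Ss : sphere_proj X s by exists x => //; split => //; exact/eqP.
have [p pc sp] := hc _ Ss.
pose l := Num.truncn (norm2 x / e).
have /andP[l1 l2] := truncn_itv (ltW (divr_gt0 nx e0)).
rewrite -/l ler_pdivlMr// in l1; rewrite -/l -natr1 ltr_pdivrMr// in l2.
exists ((e * l%:R) *: p).
  have lL : l \in iota 0 L.
    rewrite mem_iota leq0n add0n /L ltnS.
    by apply: le_truncn; rewrite ler_pM2r ?invr_gt0// ltW.
  by apply/allpairsP; exists (p, l); split.
move=> i.
(* Radial error, at most e since |s_i| <= 1, plus angular error, at most r e since l e <= |x| <
   r. *)
have -> : x i 0 - ((e * l%:R) *: p) i 0 =
    (norm2 x - l%:R * e) * s i 0 + (l%:R * e) * (s i 0 - p i 0).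
  by rewrite /s !mxE; field; rewrite gt_eqF.
apply: le_trans (ler_normD _ _) _; rewrite [leRHS]mulrDl mul1r lerD//= normrM.
  apply: (@le_trans _ _ (e * 1)); last by rewrite mulr1.
  apply: ler_pM => //; first by rewrite ger0_norm; lra.
  by apply: le_trans (norm2_entry _ _) _; rewrite (sphere_proj_norm Ss).
apply: ler_pM => //.
- by rewrite ger0_norm ?mulr_ge0 ?(ltW e0)//; lra.
- by apply: le_trans sp; have := norm2_entry (s - p) i; rewrite !mxE.
Qed.

Lemma small_power (R : realType) (a D eta e0 : R) :
  0 < a -> 0 <= D -> 0 < eta -> 0 < e0 ->
  exists e, [/\ 0 < e, e < e0 & D * e `^ a <= eta].
Proof.
move=> a0 D0 eta0 e00.
pose b := eta / (D + 1).
have b0 : 0 < b by rewrite divr_gt0//; lra.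
exists (Num.min (e0 / 2) (b `^ a^-1)); split.
- by rewrite lt_min powR_gt0// andbT; lra.
- by rewrite gt_min; apply/orP; left; lra.
- apply: (@le_trans _ _ (D * b)).
    rewrite ler_wpM2l//.
    apply: (@le_trans _ _ ((b `^ a^-1) `^ a)); last first.
      by rewrite -powRrM mulVf ?gt_eqF// powRr1// ltW.
    apply: ge0_ler_powR; rewrite ?nnegrE ?powR_ge0 ?(ltW a0)//.
      by rewrite le_min powR_ge0 andbT; lra.
    by rewrite ge_min lexx orbT.
  rewrite /b mulrA ler_pdivrMr; lra.
Qed.

(** A collision moves to a pair of net points nearby: [M] keeps their images close on [J] and
    [delta] keeps the points apart. The union bound is then of order e^(q - 2(k+1)), with q = #|J|,
    which tends to 0 with e. *)
Lemma collision_prob_bounded (d : measure_display) (T : measurableType d)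
    (P : probability T RR) (m n : nat) (A : 'I_m -> 'I_n -> T -> RR)
    (k epsS r eta M delta : RR) (X : set 'cV[RR]_n) (J : seq 'I_m) :
  gaussian_entries P A -> 0 < epsS -> 0 < r -> 0 < eta -> 0 <= M -> 0 < delta ->
  (forall e : RR, 0 < e -> e < epsS ->
     (covering_number (sphere_proj X) e <= (e `^ (- k))%:E)%E) ->
  uniq J -> 2 * (k + 1) < (size J)%:R ->
  prob_le P [set w | exists x u, [/\ ball_part X r x, ball_part X r u,
      exists i, delta <= `|x i 0 - u i 0|,
      forall j i, `|A j i w| <= M &
      forall j, j \in J -> (rmatrix A w *m x) j 0 = (rmatrix A w *m u) j 0]] eta.
Proof.
move=> [mA iA gA] e00 r0 eta0 M0 d0 hS uJ kJ.
pose q := size J.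
pose K := 4 * (n%:R * M * (1 + r)) / delta.
have K0 : 0 <= K by rewrite divr_ge0 ?mulr_ge0//; lra.
pose D := n%:R * (2 * (r + 1)) ^+ 2 * K ^+ q.
have D0 : 0 <= D by apply: mulr_ge0; rewrite ?exprn_ge0// mulr_ge0// sqr_ge0.
pose a := q%:R - 2 * (k + 1).
have a0 : 0 < a by rewrite /a subr_gt0.
(* Being below 1 gives r/e + 1 <= (r+1)/e; the last bound keeps the net points delta/2 apart in
   coordinate [i0]. *)
pose e1 := Num.min epsS (Num.min 1 (delta / (4 * (1 + r)))).
have e10 : 0 < e1.
  by rewrite !lt_min e00 ltr01 divr_gt0// mulr_gt0//; lra.
have [e [ep ee1 eD]] := small_power a0 D0 eta0 e10.
move: ee1; rewrite /e1 !lt_min => /and3P[eS e1' ed].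
have rr : 0 < 4 * (1 + r) by lra.
rewrite ltr_pdivlMr// in ed.
have [c cS sc] := cover_of_covering_number (powR_gt0 (- k) ep) (hS _ ep eS).
have [Y sY hY] := ball_part_cover ep r0 cS.
have sY' : (size Y)%:R <= 2 * (r + 1) * e `^ (- (k + 1)).
  apply: le_trans sY _.
  apply: (@le_trans _ _ (2 * e `^ (- k) * (r / e + 1))).
    by rewrite ler_wpM2r// addr_ge0// divr_ge0// ltW.
  have -> : e `^ (- (k + 1)) = e `^ (- k) / e.
    rewrite opprD powRD ?powR_inv1 ?(ltW ep)//.
    by apply/implyP => _; rewrite gt_eqF.
  have -> : r / e + 1 = (r + e) / e by field; rewrite gt_eqF.
  rewrite [leRHS](_ : _ = 2 * e `^ (- k) * ((r + 1) / e)); last by field; rewrite gt_eqF.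
  rewrite ler_wpM2l ?mulr_ge0 ?powR_ge0// ler_pM2r ?invr_gt0//; lra.
(* If rows of A agree on x and u, then on y - z they equal their values on (u - z) - (x - y), whose
   n entries are at most 2 (1 + r) e. *)
pose t := 2 * (n%:R * M * ((1 + r) * e)).
have t0 : 0 <= t by rewrite !mulr_ge0//; lra.
pose Bad (z : 'cV[RR]_n * 'cV[RR]_n * 'I_n) := [set w |
  delta / 2 <= `|z.1.1 z.2 0 - z.1.2 z.2 0| /\
  forall j, j \in J -> `|\sum_i (z.1.1 i 0 - z.1.2 i 0) * A j i w| <= t].
pose s := [seq (yz, i) | yz <- [seq (y, z) | y <- Y, z <- Y], i <- enum 'I_n].
apply: (@prob_le_sub _ _ _ _ [set w | exists2 z, z \in s & Bad z w]
    ((size s)%:R * (K * e) ^+ q)).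
- move=> w [x [u [xX uX [i0 hi0] hM hJ]]].
  have S0 : sphere_proj X !=set0.
    have [x0|x0] := eqVneq x 0; last first.
      exists ((norm2 x)^-1 *: x); exists x => //; split; first by case: xX.
      exact/eqP.
    exists ((norm2 u)^-1 *: u); exists u => //; split; first by case: uX.
    move=> u0; move: hi0; rewrite x0 u0 subrr normr0; lra.
  have [y yY hy] := hY S0 _ xX; have [z zY hz] := hY S0 _ uX.
  exists (y, z, i0).
    apply/allpairsP; exists ((y, z), i0); split; rewrite ?mem_enum//.
    by apply/allpairsP; exists (y, z).
  split=> /= [|j jJ].
    have := hy i0; have := hz i0.
    have := ler_normB (x i0 0 - y i0 0 + (y i0 0 - z i0 0)) (u i0 0 - z i0 0).
    have := ler_normD (x i0 0 - y i0 0) (y i0 0 - z i0 0).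
    have -> : x i0 0 - y i0 0 + (y i0 0 - z i0 0) - (u i0 0 - z i0 0) =
      x i0 0 - u i0 0 by ring.
    lra.
  have xu : \sum_i (x i 0 - u i 0) * A j i w = 0.
    have row (v : 'cV[RR]_n) : (rmatrix A w *m v) j 0 = \sum_i v i 0 * A j i w.
      by rewrite mxE; apply: eq_bigr => i _; rewrite mxE mulrC.
    under eq_bigr do rewrite mulrBl.
    by rewrite sumrB -!row hJ// subrr.
  have -> : \sum_i (y i 0 - z i 0) * A j i w =
      \sum_i ((u i 0 - z i 0) - (x i 0 - y i 0)) * A j i w.
    apply/eqP; rewrite -subr_eq0 -sumrB -[X in _ == X]xu; apply/eqP.
    by apply: eq_bigr => i _; ring.
  apply: le_trans (ler_norm_sum _ _ _) _.
  have -> : t = \sum_(i < n) (2 * (1 + r) * e) * M.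
    by rewrite sumr_const card_ord -mulr_natl /t; ring.
  apply: ler_sum => i _; rewrite normrM; apply: ler_pM => //.
  by apply: le_trans (ler_normB _ _) _; have := hy i; have := hz i; lra.
- rewrite /s !size_allpairs size_enum_ord !natrM.
  set B := 2 * (r + 1) * e `^ (- (k + 1)) in sY'.
  apply: (@le_trans _ _ (B * B * n%:R * (K * e) ^+ q)).
    have Ke : 0 <= (K * e) ^+ q by rewrite exprn_ge0// mulr_ge0// ltW.
    by rewrite ler_wpM2r// ler_wpM2r// ler_pM.
  apply: le_trans eD; rewrite le_eqVlt; apply/orP; left; apply/eqP.
  have -> : e `^ a = e `^ (- (k + 1)) * e `^ (- (k + 1)) * e ^+ q.
    have ene : e != 0 by rewrite gt_eqF.
    rewrite -powR_mulrn ?(ltW ep)// -!powRD ?ene ?implybT//.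
    by congr (_ `^ _); rewrite /a; ring.
  by rewrite /B /D exprMn; ring.
apply: prob_le_seq => -[[y z] i0] _.
(* Pairs of net points closer than delta/2 in coordinate [i0] have an empty bad event. *)
have [small|large] := ltP `|y i0 0 - z i0 0| (delta / 2).
  exists set0; last by rewrite measure0 lee_fin exprn_ge0// mulr_ge0// ltW.
  by split=> // w [/= + _]; rewrite leNgt small.
have v0 : y i0 0 - z i0 0 != 0 by rewrite -normr_gt0; lra.
have [mE PE] := @gaussian_rows_small_ball _ _ (RR : realType) P m n _
  (fun i => y i 0 - z i 0) i0 t J mA iA gA v0 t0 uJ.
apply: (@prob_le_sub _ _ _ _ _ _ _ _ _ (prob_le_measurable mE PE)).
  by move=> w [].
apply: lerXn2r; first by rewrite nnegrE divr_ge0.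
  by rewrite nnegrE (mulr_ge0 K0 (ltW ep)).
rewrite ler_pdivrMr ?normr_gt0//.
apply: (@le_trans _ _ (K * e * (delta / 2))).
  by rewrite /K /t le_eqVlt; apply/orP; left; apply/eqP; field; rewrite gt_eqF.
by rewrite ler_wpM2l// mulr_ge0// ltW.
Qed.

(** The cutoffs are removed by a countable union: each collision has entries at most N and some
    coordinate gap at least 1/(N+1) for a suitable N. The sets [J] are finitely many. *)
Lemma collision_prob (d : measure_display) (T : measurableType d)
    (P : probability T RR) (m n : nat) (A : 'I_m -> 'I_n -> T -> RR)
    (k epsS r eta : RR) (X : set 'cV[RR]_n) :
  gaussian_entries P A -> 0 < epsS -> 0 < r -> 0 < eta ->
  (forall e : RR, 0 < e -> e < epsS ->
     (covering_number (sphere_proj X) e <= (e `^ (- k))%:E)%E) ->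
  prob_le P [set w | exists x u (J : {set 'I_m}),
      [/\ ball_part X r x, ball_part X r u, x <> u, 2 * (k + 1) < #|J|%:R &
      forall j, j \in J -> (rmatrix A w *m x) j 0 = (rmatrix A w *m u) j 0]] eta.
Proof.
move=> gA e0 r0 eta0 hS.
pose s := [seq J : {set 'I_m} <- enum {set 'I_m} | 2 * (k + 1) < #|J|%:R].
pose Col N (J : {set 'I_m}) := [set w | exists x u, [/\ ball_part X r x, ball_part X r u,
      exists i, (N.+1%:R)^-1 <= `|x i 0 - u i 0|,
      forall j i, `|A j i w| <= N%:R &
      forall j, j \in enum J -> (rmatrix A w *m x) j 0 = (rmatrix A w *m u) j 0]].
apply: (@prob_le_sub _ _ _ _ (\bigcup_N [set w | exists2 J, J \in s & Col N J w])
  _ _ _ (lexx _)).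
  move=> w [x [u [J [xX uX xu kJ hJ]]]].
  have [i0 xui] : exists i, x i 0 - u i 0 != 0.
    apply: contrapT => h; apply: xu; apply/matrixP => i j; rewrite ord1.
    by apply/eqP; rewrite -subr_eq0; apply: contraPT isT => ne _; apply: h; exists i.
  pose S := \sum_j \sum_i `|A j i w|.
  pose N := Num.bound (S + `|x i0 0 - u i0 0|^-1).
  have S0 : 0 <= S by apply: sumr_ge0 => j _; exact: sumr_ge0.
  have hN : S + `|x i0 0 - u i0 0|^-1 < N%:R.
    by apply: archi_boundP; rewrite addr_ge0.
  have v0 : 0 <= `|x i0 0 - u i0 0|^-1 by rewrite invr_ge0.
  exists N => //; exists J; first by rewrite mem_filter kJ mem_enum.
  exists x, u; split => //.
  - exists i0; rewrite -[leRHS]invrK lef_pV2 ?posrE ?invr_gt0 ?normr_gt0//.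
    by rewrite -natr1; lra.
  - move=> j i; apply: (@le_trans _ _ S); last by lra.
    rewrite /S (bigD1 j)//= (bigD1 i)//= -addrA lerDl addr_ge0//.
      exact: sumr_ge0.
    by apply: sumr_ge0 => ? _; exact: sumr_ge0.
  - by move=> j; rewrite mem_enum; exact: hJ.
apply: prob_le_bigcup; first exact: ltW.
move=> N; have eN : 0 < eta / 2 ^+ N.+1 by rewrite divr_gt0// exprn_gt0.
set b := eta / _ in eN *.
have s0 : 0 < (size s).+1%:R :> RR by [].
(* The successor in the denominator avoids dividing by zero when no [J] is large enough. *)
apply: (@prob_le_sub _ _ _ _ _ ((size s)%:R * (b / (size s).+1%:R)) _ (fun _ => id)).
  rewrite mulrCA ler_piMr ?(ltW eN)// ler_pdivrMr// mul1r.
  by rewrite -natr1 lerDl.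
apply: prob_le_seq => J; rewrite mem_filter => /andP[kJ _].
apply: (@collision_prob_bounded _ _ _ _ _ _ k epsS r _ N%:R (N.+1%:R)^-1 X (enum J)) => //.
- by rewrite divr_gt0.
- exact: enum_uniq.
- by rewrite -cardE.
Qed.

(** * Combination of the two events *)

(** The common clipped value lies strictly between -mu and mu, so z is unclipped at j as well. *)
Lemma clip_unsaturated (mu : RR) (m : nat) (y z : 'cV[RR]_m) (j : 'I_m) :
  0 < mu -> clip mu y = clip mu z -> ~~ (mu <= `|y j 0|) -> y j 0 = z j 0.
Proof.
move=> mu0 /matrixP /(_ j 0); rewrite !mxE -ltNge ltr_norml => + /andP[y1 y2].
rewrite leNgt y1/= leNgt y2/=.
case: (leP (z j 0) (- mu)) => [_ yz|z1]; first by move: y1; rewrite yz ltxx.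
by case: (leP mu (z j 0)) => [_ yz|//]; move: y2; rewrite yz ltxx.
Qed.

Theorem theorem1 :
  exists C : RR, 0 < C /\
  forall (m n : nat) (mu : RR) (X : set 'cV[RR]_n) (k epsS r : RR)
         (d : measure_display) (T : measurableType d) (P : probability T RR)
         (A : 'I_m -> 'I_n -> T -> RR),
    0 < mu ->
    is_cone X ->
    (upper_box_dim (sphere_proj X) < k%:E)%E ->
    0 < epsS -> epsS < 1 / 2 ->
    (forall e : RR, 0 < e -> e < epsS ->
       (covering_number (sphere_proj X) e <= (e `^ (- k))%:E)%E) ->
    (forall i j, measurable_fun setT (A i j : T -> (RR : realType))) ->
    mutually_independent P (fun ij : 'I_m * 'I_n => A ij.1 ij.2) ->
    (forall i j (B : set RR), measurable (B : set (RR : realType)) ->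
       P (A i j @^-1` B) = normal_prob 0 1 B) ->
    k * ln (1 / epsS) <= m%:R ->
    0 < r -> r < mu * (1 / 2 - (k + 1) / m%:R) ->
    prob_le P
      [set w | exists x u, [/\ ball_part X r x, ball_part X r u, x <> u &
                  clip mu (rmatrix A w *m x) = clip mu (rmatrix A w *m u)]]
      (12 * expR (- (C * m%:R))).
Proof.
(* The value 1/30 fits the numerical slack in both ranges of tau. *)
exists (1 / 30); split; first by lra.
move=> m n mu X k epsS r d T P A mu0 _ _ e0 e12 hS mA iA gA ke r0 rmu.
have gaussA : gaussian_entries P A by split=> [e|//|e B]; [exact: mA|exact: gA].
(* For m < 30 the claimed bound is at least 12/e >= 3, hence trivial; otherwise C m >= 1, as
   chaining requires. *)
have [Cm|Cm] := ltP (1 / 30 * m%:R) (1 : RR).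
  apply: prob_le_ge1.
  have : expR (- (1 / 30 * m%:R)) >= expR (- 1) :> RR by rewrite ler_expR; lra.
  have : 1 / 4 <= expR (- 1) :> RR.
    have -> : - 1 = 2%:R * (- (1 / 2)) :> RR by lra.
    have := expR_ge1Dx (- (1 / 2) : (RR : realType)).
    by rewrite expRM_natl => h; nra.
  lra.
have m0 : 0 < m%:R :> RR by lra.
(* Any positive value would do for the null collision event; this one gives the total 4 + 1 <=
   12. *)
pose eta : RR := expR (- (1 / 30 * m%:R)).
have eta0 : 0 < eta by exact: expR_gt0.
have hE1 := saturation_prob gaussA mu0 e0 e12 hS ke r0 rmu Cm.
have hE2 := collision_prob gaussA e0 r0 eta0 hS.
apply: (prob_le_sub _ _ (prob_leU hE1 hE2)); last by rewrite -/eta; lra.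
move=> w [x [u [xX uX xu cl]]].
set tau := 1 / 2 - _ in rmu hE1 *.
have [sat|unsat] := leP (m%:R * (2 * tau))
  (#|[pred j | (mu <= `|(rmatrix A w *m x) j 0|)%R]|%:R).
  by left; exists x.
(* Fewer than 2 tau m clipped coordinates leave more than m - 2 tau m = 2 (k + 1) unclipped ones. *)
right; exists x, u, [set j | ~~ (mu <= `|(rmatrix A w *m x) j 0|)]%SET; split => //.
  have cardJ := cardC [pred j | (mu <= `|(rmatrix A w *m x) j 0|)%R].
  have -> : 2 * (k + 1) = m%:R - m%:R * (2 * tau).
    by rewrite /tau; field; rewrite gt_eqF.
  rewrite -{1}(card_ord m) -cardJ natrD.
  have -> : #|[set j | ~~ (mu <= `|(rmatrix A w *m x) j 0|)]%SET| =
      #|[predC [pred j | (mu <= `|(rmatrix A w *m x) j 0|)%R]]|.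
    by apply: eq_card => j; rewrite !inE.
  lra.
by move=> j; rewrite inE => hj; exact: clip_unsaturated cl hj.
Qed.
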